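(* Let $R$ be a commutative Noetherian local ring. If $R$ is Gorenstein, then the following statements are equivalent. (i) $R$ is complete and ${}^{\boldsymbol\perp}R=\mathrm{GProj}\,R$. (ii) $R$ is Artinian.
   Context: $\mathrm{Mod}\,R$ is the category of all $R$-modules. ${}^{\boldsymbol\perp}R=\{A\in\mathrm{Mod}\,R\mid\mathrm{Ext}^n_R(A,R)=0\ \forall n\ge1\}$. An acyclic complex $P^\bullet$ of projective $R$-modules is totally acyclic if $\mathrm{Hom}_R(P^\bullet,P)$ is acyclic for every projective $P$; a module is Gorenstein-projective if it is $\mathrm{Coker}(P^{-1}\to P^0)$ for such a $P^\bullet$, and $\mathrm{GProj}\,R$ is the full subcategory of $\mathrm{Mod}\,R$ of all Gorenstein-projective modules. $R$ is Gorenstein if it has finite injective dimension over itself. *)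

(* Defs.v *)
From HB Require Import structures.
From mathcomp Require Import all_boot all_order all_algebra.
From mathcomp Require Import classical_sets.

Set Implicit Arguments.
Unset Strict Implicit.
Unset Printing Implicit Defensive.

Import GRing.Theory.
Local Open Scope classical_set_scope.
Local Open Scope ring_scope.

(** * Commutative rings *)

Definition ideal (R : comNzRingType) (I : set R) : Prop :=
  [/\ I 0, (forall x y, I x -> I y -> I (x + y)) & forall a x, I x -> I (a * x)].

Definition maximal_ideal (R : comNzRingType) (m : set R) : Prop :=
  [/\ ideal m, m <> setT &
      forall I : set R, ideal I -> m `<=` I -> I = m \/ I = setT].

Definition local_ring (R : comNzRingType) (m : set R) : Prop :=
  maximal_ideal m /\ forall n : set R, maximal_ideal n -> n = m.

Definition noetherian_ring (R : comNzRingType) : Prop :=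
  forall I : nat -> set R, (forall n, ideal (I n)) ->
    (forall n, I n `<=` I n.+1) ->
    exists N, forall n, (N <= n)%N -> I n = I N.

Definition artinian_ring (R : comNzRingType) : Prop :=
  forall I : nat -> set R, (forall n, ideal (I n)) ->
    (forall n, I n.+1 `<=` I n) ->
    exists N, forall n, (N <= n)%N -> I n = I N.

(** The [k]-th power of the ideal [I]: finite sums of multiples of products of
    [k] elements of [I]; for [k = 0] the product is empty and this is [R]. *)
Definition ideal_pow (R : comNzRingType) (I : set R) (k : nat) : set R :=
  [set x | exists (n : nat) (c : 'I_n -> R) (y : 'I_n -> 'I_k -> R),
     (forall i j, I (y i j)) /\ x = \sum_(i < n) c i * \prod_(j < k) y i j].

Definition adic_cauchy (R : comNzRingType) (I : set R) (x : nat -> R) : Prop :=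
  forall k, exists N, forall i j,
    (N <= i)%N -> (N <= j)%N -> ideal_pow I k (x i - x j).

Definition adic_limit (R : comNzRingType) (I : set R) (x : nat -> R) (l : R) :
  Prop := forall k, exists N, forall i, (N <= i)%N -> ideal_pow I k (x i - l).

(** Separated and every Cauchy sequence converges, that is, the canonical map
    from [R] to the inverse limit of the [R / I^k] is bijective. *)
Definition adically_complete (R : comNzRingType) (I : set R) : Prop :=
  (forall x, (forall k, ideal_pow I k x) -> x = 0) /\
  (forall x, adic_cauchy I x -> exists l, adic_limit I x l).

(** * Modules *)

Definition surjective_map (A B : Type) (f : A -> B) : Prop :=
  forall y, exists x, f x = y.

Definition exact_at (R : comNzRingType) (A B C : lmodType R)
    (f : {linear A -> B}) (g : {linear B -> C}) : Prop :=
  forall y : B, g y = 0 <-> exists x : A, y = f x.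

Definition projective_module (R : comNzRingType) (P : lmodType R) : Prop :=
  forall (M N : lmodType R) (g : {linear M -> N}) (f : {linear P -> N}),
    surjective_map g -> exists h : {linear P -> M}, forall x, g (h x) = f x.

Definition injective_module (R : comNzRingType) (E : lmodType R) : Prop :=
  forall (M N : lmodType R) (i : {linear M -> N}) (f : {linear M -> E}),
    injective i -> exists h : {linear N -> E}, forall x, h (i x) = f x.

(** ** Ext *)

Record projective_resolution (R : comNzRingType) (A : lmodType R) :=
  ProjectiveResolution {
    pres_obj :> nat -> lmodType R;
    pres_diff : forall n, {linear pres_obj n.+1 -> pres_obj n};
    pres_aug : {linear pres_obj 0%N -> A};
    pres_proj : forall n, projective_module (pres_obj n);
    pres_aug_surj : surjective_map pres_aug;
    pres_exact0 : exact_at (pres_diff 0%N) pres_aug;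
    pres_exactS : forall n, exact_at (pres_diff n.+1) (pres_diff n)
  }.

Definition Ext_cocycle (R : comNzRingType) (A B : lmodType R)
    (P : projective_resolution A) (n : nat) (f : {linear P n -> B}) : Prop :=
  forall x, f (pres_diff P n x) = 0.

Definition Ext_coboundary (R : comNzRingType) (A B : lmodType R)
    (P : projective_resolution A) (n : nat) : {linear P n -> B} -> Prop :=
  match n with
  | 0 => fun f => forall x, f x = 0
  | k.+1 => fun f =>
      exists g : {linear P k -> B}, forall x, f x = g (pres_diff P k x)
  end.

(** [Ext^n(A, B) = H^n(Hom(P, B))] is zero. The cohomology does not depend on
    the projective resolution [P], and every module has one (a free one), so
    quantifying universally or existentially over [P] is the same. *)
Definition Ext_vanishes (R : comNzRingType) (n : nat) (A B : lmodType R) :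
    Prop :=
  forall (P : projective_resolution A) (f : {linear P n -> B}),
    Ext_cocycle f -> Ext_coboundary f.

Definition left_perp (R : comNzRingType) (B A : lmodType R) : Prop :=
  forall n, (1 <= n)%N -> Ext_vanishes n A B.

(** ** Injective dimension *)

Record injective_resolution (R : comNzRingType) (A : lmodType R) :=
  InjectiveResolution {
    ires_obj :> nat -> lmodType R;
    ires_diff : forall n, {linear ires_obj n -> ires_obj n.+1};
    ires_coaug : {linear A -> ires_obj 0%N};
    ires_inj : forall n, injective_module (ires_obj n);
    ires_coaug_inj : injective ires_coaug;
    ires_exact0 : exact_at ires_coaug (ires_diff 0%N);
    ires_exactS : forall n, exact_at (ires_diff n) (ires_diff n.+1)
  }.

Definition injdim_le (R : comNzRingType) (A : lmodType R) (d : nat) : Prop :=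
  exists I : injective_resolution A,
    forall n, (d < n)%N -> forall x : I n, x = 0.

Definition gorenstein_ring (R : comNzRingType) : Prop :=
  exists d, injdim_le (R^o : lmodType R) d.

(** ** Gorenstein-projective modules *)

Record complex (R : comNzRingType) := Complex {
  cplx_obj :> int -> lmodType R;
  cplx_diff : forall i : int, {linear cplx_obj i -> cplx_obj (i + 1)};
  cplx_diffK : forall i x, cplx_diff (i + 1) (cplx_diff i x) = 0
}.

Definition acyclic (R : comNzRingType) (P : complex R) : Prop :=
  forall i, exact_at (cplx_diff P i) (cplx_diff P (i + 1)).

(** Acyclicity of the complex [Hom(P, Q)], whose differentials are the
    precompositions with those of [P]: exactness at [Hom(P (i + 1), Q)]. *)
Definition Hom_acyclic (R : comNzRingType) (P : complex R) (Q : lmodType R) :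
    Prop :=
  forall (i : int) (f : {linear P (i + 1) -> Q}),
    (forall x, f (cplx_diff P i x) = 0) <->
    exists g : {linear P (i + 1 + 1) -> Q},
      forall x, f x = g (cplx_diff P (i + 1) x).

Definition totally_acyclic (R : comNzRingType) (P : complex R) : Prop :=
  [/\ forall i, projective_module (P i), acyclic P &
      forall Q : lmodType R, projective_module Q -> Hom_acyclic P Q].

Definition is_cokernel (R : comNzRingType) (A B C : lmodType R)
    (f : {linear A -> B}) (p : {linear B -> C}) : Prop :=
  surjective_map p /\ exact_at f p.

(** The target of [cplx_diff P (-1)] is [P (-1 + 1)], convertible to [P 0]. *)
Definition gorenstein_projective (R : comNzRingType) (A : lmodType R) : Prop :=
  exists2 P : complex R, totally_acyclic P &
    exists p : {linear P 0 -> A}, is_cokernel (cplx_diff P (- 1)) p.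

(* Main.v *)
Require Import Defs.
From mathcomp Require Import all_boot all_order all_algebra.
From mathcomp Require Import classical_sets.
From HB Require Import structures.
From mathcomp Require Import boolp functions generic_quotient ring.

(**
   (i) => (ii). For [x] in the maximal ideal, the localization [R_x] is the
   cokernel of [1 - x X] on [R[X]]. Completeness makes every sequence [b] of the
   form [b_k = a_k - x a_(k+1)], so maps into [R] extend along this short free
   resolution and [R_x] lies in the left perpendicular of [R]. If [R_x] is then
   Gorenstein-projective, it embeds in a free module; but its elements are
   divisible by all powers of [x], so separatedness forces [R_x = 0] and [x] is
   nilpotent. A Noetherian local ring with nil maximal ideal is Artinian.

   (ii) => (i). Now the maximal ideal is nilpotent, so [R] is complete, and
   injectivity can be tested on maps out of the maximal ideal. Shifting along an
   injective resolution with the help of a socle element, a module of finite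
   injective dimension is injective. Hence [R] is injective, and so are the free
   and the projective modules. Every module embeds in a free one, so every module
   is both left orthogonal to [R] and Gorenstein-projective. *)

Set Implicit Arguments.
Unset Strict Implicit.
Unset Printing Implicit Defensive.

Import GRing.Theory.
Local Open Scope classical_set_scope.
Local Open Scope ring_scope.

(** * Submodules, lifting and extension of linear maps *)

Section Modules.
Variable R : comNzRingType.
Implicit Types M N E P A B C : lmodType R.

Definition linear_map A B (f : A -> B) (lin_f : linear f) : {linear A -> B} :=
  HB.pack f (GRing.isLinear.Build R A B *:%R f lin_f).

Definition submod M (S : set M) : Prop :=
  S 0 /\ forall a x y, S x -> S y -> S (a *: x + y).

Section SubmodTheory.
Variables (M : lmodType R) (S : set M).
Hypothesis subS : submod S.

Lemma submod0 : S 0. Proof. by case: subS. Qed.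

Lemma submodZ a x : S x -> S (a *: x).
Proof. by case: subS => S0 SL Sx; rewrite -[_ *: _]addr0; apply: SL. Qed.

Lemma submodD x y : S x -> S y -> S (x + y).
Proof. by case: subS => _ SL Sx Sy; rewrite -[x]scale1r; apply: SL. Qed.

Lemma submodB x y : S x -> S y -> S (x - y).
Proof. by move=> Sx Sy; rewrite -scaleN1r; apply/submodD/submodZ. Qed.

End SubmodTheory.

(** The proof is a parameter so that the closure instance below can recover it from the
    predicate. *)
Definition submod_pred M (S : set M) of submod S : {pred M} :=
  fun x => `[< S x >].

Lemma submod_pred_closed M (S : set M) (subS : submod S) :
  submod_closed (submod_pred subS).
Proof.
split; first exact/asboolP/(submod0 subS).
move=> a x y /asboolP Sx /asboolP Sy; apply/asboolP.
by case: subS => _; apply.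
Qed.

HB.instance Definition _ M (S : set M) (subS : submod S) :=
  GRing.isSubmodClosed.Build R M (submod_pred subS)
    (submod_pred_closed subS).

Record submodule M (S : set M) (subS : submod S) :=
  Submodule { submodule_val : M; _ : submodule_val \in submod_pred subS }.

Section SubmoduleInstances.
Variables (M : lmodType R) (S : set M) (subS : submod S).
HB.instance Definition _ := [isSub for @submodule_val M S subS].
HB.instance Definition _ := [Choice of submodule subS by <:].
HB.instance Definition _ := [SubChoice_isSubLmodule of submodule subS by <:].

(* Opaque, so that simplification does not expose the underlying record. *)
Lemma submodule_incl_spec : {f : {linear submodule subS -> M} | f =1 \val}.
Proof. by exists \val. Qed.

Definition submodule_incl : {linear submodule subS -> M} :=
  sval submodule_incl_spec.

Lemma submodule_inclE : submodule_incl =1 \val.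
Proof. exact: (svalP submodule_incl_spec). Qed.

Lemma submodule_incl_inj : injective submodule_incl.
Proof. by move=> x y; rewrite !submodule_inclE => /val_inj. Qed.

Lemma submodule_inclP x : S (submodule_incl x).
Proof. by rewrite submodule_inclE; apply/asboolP/(valP x). Qed.

Lemma submodule_incl_onto x : S x -> exists y, submodule_incl y = x.
Proof. by move=> /asboolP Sx; exists (Submodule Sx); rewrite submodule_inclE. Qed.

End SubmoduleInstances.

(* A linear map defined on a submodule of [N] is represented by its graph, a
   single-valued submodule of [N * E]; this avoids working in subtypes. *)
Definition single_valued N E (G : set (N * E)) : Prop :=
  forall e, G (0, e) -> e = 0.

Lemma single_valued_eq N E (G : set (N * E)) x e e' : submod G ->
  single_valued G -> G (x, e) -> G (x, e') -> e = e'.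
Proof.
move=> subG svG Gx Gx'; apply/eqP; rewrite -subr_eq0; apply/eqP/svG.
by have : G (x - x, e - e') := submodB subG Gx Gx'; rewrite subrr.
Qed.

Lemma linear_of_graph N E (G : set (N * E)) : submod G -> single_valued G ->
  (forall x, exists e, G (x, e)) ->
  exists f : {linear N -> E}, forall x, G (x, f x).
Proof.
move=> subG svG /choice[f Gf].
have lin_f : linear f.
  move=> a x y; apply: (single_valued_eq subG svG (Gf _)).
  by case: subG => _ /(_ a _ _ (Gf x) (Gf y)).
by exists (linear_map lin_f).
Qed.

(** [G] is the graph of a linear map on its domain; injectivity is applied to the inclusion of that
    domain in [N]. *)
Lemma injective_extend N E (G : set (N * E)) : injective_module E ->
  submod G -> single_valued G ->
  exists f : {linear N -> E}, forall x e, G (x, e) -> f x = e.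
Proof.
move=> injE subG svG.
have subD : submod [set x | exists e, G (x, e)].
  split; first by exists 0; apply: (submod0 subG).
  move=> a x y [e Gx] [e' Gy]; exists (a *: e + e').
  by case: subG => _ /(_ a _ _ Gx Gy).
pose i := submodule_incl subD.
have [|||g Gg] :=
    @linear_of_graph (submodule subD) E [set p | G (i p.1, p.2)].
- split; first by change (G (i 0, 0)); rewrite linear0; apply: (submod0 subG).
  move=> a [x e] [y e'] /= Gx Gy.
  change (G (i (a *: x + y), a *: e + e')); rewrite linearP.
  by case: subG => _ /(_ a _ _ Gx Gy).
- by move=> e; change (G (i 0, e) -> e = 0); rewrite linear0; apply: svG.
- by move=> x; apply: (submodule_inclP x).
have [f fP] := injE _ _ i g (@submodule_incl_inj _ _ subD).
exists f => x e Gx.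
have [x' x'E] := submodule_incl_onto subD (ex_intro _ e Gx).
by rewrite -x'E in Gx *; rewrite fP; apply: (single_valued_eq subG svG (Gg x')).
Qed.

(** The pullback of [h] and [g] projects onto [P]; a section of this projection, followed by the
    projection to [M], is the lift. *)
Lemma projective_lift P M B (h : {linear P -> B}) (g : {linear M -> B}) :
  projective_module P -> (forall p, exists m, g m = h p) ->
  exists l : {linear P -> M}, forall p, g (l p) = h p.
Proof.
move=> projP gh.
have subS : submod [set q : P * M | h q.1 = g q.2].
  split; first by rewrite /= !linear0.
  by move=> a [p m] [p' m'] /= e e'; rewrite !linearP e e'.
pose i := submodule_incl subS.
have lin1 : linear (fun q => (i q).1) by move=> a x y; rewrite linearP.
have lin2 : linear (fun q => (i q).2) by move=> a x y; rewrite linearP.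
have [p|l lE] := projP _ _ (linear_map lin1) idfun.
  have [m gm] := gh p.
  have [//|q qE] := @submodule_incl_onto _ _ subS (p, m).
  by exists q; change ((i q).1 = p); rewrite /i qE.
exists (linear_map lin2 \o l) => p /=.
have := submodule_inclP (l p); rewrite /= -/(i (l p)) => <-.
by congr (h _); apply: (lE p).
Qed.

Lemma exact_lift P A B C (f : {linear A -> B}) (g : {linear B -> C})
    (h : {linear P -> B}) :
  projective_module P -> exact_at f g -> (forall p, g (h p) = 0) ->
  exists l : {linear P -> A}, forall p, f (l p) = h p.
Proof.
move=> projP ex_fg gh0; apply: projective_lift => // p.
by have [/(_ (gh0 p))[a ->] _] := ex_fg (h p); exists a.
Qed.

(** The relation [g b |-> h b] is single-valued because [h] vanishes on the kernel of [g], which is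
    the image of [f]. *)
Lemma exact_extend E A B C (f : {linear A -> B}) (g : {linear B -> C})
    (h : {linear B -> E}) :
  injective_module E -> exact_at f g -> (forall a, h (f a) = 0) ->
  exists l : {linear C -> E}, forall b, h b = l (g b).
Proof.
move=> injE ex_fg hf0.
have [||l lE] := @injective_extend C E [set q | exists b, q = (g b, h b)] injE.
- split; first by exists 0; rewrite !linear0.
  by move=> a _ _ [b ->] [b' ->]; exists (a *: b + b'); rewrite !linearP.
- move=> _ [b [/esym gb0 ->]].
  by have [/(_ gb0)[a ->] _] := ex_fg b; rewrite hf0.
- by exists l => b; rewrite (lE (g b) (h b)) //; exists b.
Qed.

End Modules.

(** * Quotients and free modules *)

Section Quotients.
Variables (R : comNzRingType) (M : lmodType R) (S : set M).
Hypothesis subS : submod S.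

Definition congruent : rel M := fun x y => `[< S (x - y) >].

Lemma congruent_refl : reflexive congruent.
Proof. by move=> x; apply/asboolP; rewrite subrr; apply: submod0. Qed.

Lemma congruent_sym : symmetric congruent.
Proof.
suff sub x y : congruent x y -> congruent y x.
  by move=> x y; apply/idP/idP; apply: sub.
move=> /asboolP Sxy; apply/asboolP; rewrite -opprB -scaleN1r.
exact: submodZ.
Qed.

Lemma congruent_trans : transitive congruent.
Proof.
move=> y x z /asboolP Sxy /asboolP Syz; apply/asboolP.
by rewrite -(subrKA y); apply: submodD.
Qed.

Canonical congruent_equiv :=
  EquivRel congruent congruent_refl congruent_sym congruent_trans.

Definition quotient := {eq_quot congruent_equiv}%qT.
HB.instance Definition _ := Choice.on quotient.
HB.instance Definition _ := EqQuotient.on quotient.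

Definition quotient_mk (x : M) : quotient := \pi_quotient%qT x.
Local Notation mk := quotient_mk.

Lemma quotient_mkP x y : mk x = mk y <-> S (x - y).
Proof. by split=> [/eqquotP/asboolP|Sxy] //; apply/eqquotP/asboolP. Qed.

Lemma quotient_reprK : cancel repr mk. Proof. exact: reprK. Qed.

Lemma quotient_repr x : S (repr (mk x) - x).
Proof. by apply/quotient_mkP; rewrite quotient_reprK. Qed.

Definition quotient_add (a b : quotient) := mk (repr a + repr b).
Definition quotient_opp (a : quotient) := mk (- repr a).
Definition quotient_scale (r : R) (a : quotient) := mk (r *: repr a).

Lemma quotient_addE x y : quotient_add (mk x) (mk y) = mk (x + y).
Proof.
apply/quotient_mkP; rewrite opprD addrACA; apply: submodD => //.
  exact: quotient_repr.
exact: quotient_repr.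
Qed.

Lemma quotient_oppE x : quotient_opp (mk x) = mk (- x).
Proof.
apply/quotient_mkP; rewrite -opprD -[- (_ - _)]scaleN1r; apply: submodZ => //.
exact: quotient_repr.
Qed.

Lemma quotient_scaleE r x : quotient_scale r (mk x) = mk (r *: x).
Proof.
apply/quotient_mkP; rewrite -scalerBr; apply: submodZ => //.
exact: quotient_repr.
Qed.

Lemma quotientW (P : quotient -> Prop) : (forall x, P (mk x)) -> forall a, P a.
Proof. by move=> Pmk a; rewrite -[a]quotient_reprK. Qed.

Lemma quotient_addA : associative quotient_add.
Proof. by do 3![elim/quotientW=> ?]; rewrite !quotient_addE addrA. Qed.

Lemma quotient_addC : commutative quotient_add.
Proof. by do 2![elim/quotientW=> ?]; rewrite !quotient_addE addrC. Qed.

Lemma quotient_add0 : left_id (mk 0) quotient_add.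
Proof. by elim/quotientW=> ?; rewrite quotient_addE add0r. Qed.

Lemma quotient_addN : left_inverse (mk 0) quotient_opp quotient_add.
Proof. by elim/quotientW=> ?; rewrite quotient_oppE quotient_addE addNr. Qed.

HB.instance Definition _ := GRing.isZmodule.Build quotient
  quotient_addA quotient_addC quotient_add0 quotient_addN.

Lemma quotient_scaleA r s a :
  quotient_scale r (quotient_scale s a) = quotient_scale (r * s) a.
Proof. by elim/quotientW: a => ?; rewrite !quotient_scaleE scalerA. Qed.

Lemma quotient_scale1 : left_id 1 quotient_scale.
Proof. by elim/quotientW=> ?; rewrite quotient_scaleE scale1r. Qed.

Lemma quotient_scaleDr : right_distributive quotient_scale +%R.
Proof.
move=> r; elim/quotientW=> x; elim/quotientW=> y.
change (quotient_scale r (quotient_add (mk x) (mk y)) =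
  quotient_add (quotient_scale r (mk x)) (quotient_scale r (mk y))).
by rewrite !(quotient_addE, quotient_scaleE) scalerDr.
Qed.

Lemma quotient_scaleDl a :
  {morph quotient_scale^~ a : r s / r + s >-> r + s}.
Proof.
move=> r s; elim/quotientW: a => x.
by rewrite !quotient_scaleE [RHS]quotient_addE scalerDl.
Qed.

HB.instance Definition _ := GRing.Zmodule_isLmodule.Build R quotient
  quotient_scaleA quotient_scale1 quotient_scaleDr quotient_scaleDl.

Lemma quotient_mk_linear : linear (mk : M -> quotient).
Proof. by move=> a x y; rewrite -quotient_addE -quotient_scaleE. Qed.

Definition quotient_map : {linear M -> quotient} :=
  linear_map quotient_mk_linear.

Lemma quotient_map_surj : surjective_map quotient_map.
Proof. by elim/quotientW=> x; exists x. Qed.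

Lemma quotient_map_eq0 x : quotient_map x = 0 <-> S x.
Proof. by rewrite -[x in S x]subr0; apply: quotient_mkP. Qed.

End Quotients.

(** * Free modules as finitely supported functions *)

Section FreeModules.
Variables (R : comNzRingType) (X : choiceType).

Definition finitely_supported : set (X -> R^o) :=
  [set u | exists s : seq X, forall x, u x != 0 -> x \in s].

Lemma finitely_supported_submod :
  submod (finitely_supported : set (X -> R^o : lmodType R)).
Proof.
split; first by exists [::] => x; rewrite eqxx.
move=> a u v [s us] [t vt]; exists (s ++ t) => x; rewrite mem_cat.
apply: contraTT; rewrite negb_or => /andP[xs xt].
have /negPn/eqP u0 := contra (us x) xs.
have /negPn/eqP v0 := contra (vt x) xt.
by rewrite negbK; apply/eqP; change (a * u x + v x = 0); rewrite u0 v0 mulr0 addr0.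
Qed.

Definition free_module : lmodType R := submodule finitely_supported_submod.

Definition fcoef (u : free_module) (x : X) : R :=
  submodule_incl finitely_supported_submod u x.

Lemma fcoefP u v : (forall x, fcoef u x = fcoef v x) -> u = v.
Proof. by move=> uv; apply/submodule_incl_inj/funext/uv. Qed.

Lemma fcoef_finite u : exists s : seq X, forall x, fcoef u x != 0 -> x \in s.
Proof. exact: submodule_inclP u. Qed.

Lemma free_module_of (c : X -> R) (s : seq X) :
  (forall x, c x != 0 -> x \in s) -> exists u, fcoef u =1 c.
Proof.
move=> cs; have [|u uE] := @submodule_incl_onto _ _ _ finitely_supported_submod c.
  by exists s.
by exists u => x; rewrite /fcoef uE.
Qed.

Lemma fcoef_linear x : linear (fcoef^~ x : free_module -> R^o).
Proof. by move=> a u v; rewrite /fcoef linearP. Qed.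

Definition fcoef_map x : {linear free_module -> R^o} :=
  linear_map (fcoef_linear x).

Lemma fcoefD u v x : fcoef (u + v) x = fcoef u x + fcoef v x.
Proof. by rewrite /fcoef linearD. Qed.

Lemma fcoefZ a u x : fcoef (a *: u) x = a * fcoef u x.
Proof. by rewrite /fcoef linearZ. Qed.

Lemma fcoef0 x : fcoef 0 x = 0.
Proof. by rewrite /fcoef linear0. Qed.

Lemma free_basis_exists x : exists u, forall y, fcoef u y = (y == x)%:R.
Proof.
apply: (@free_module_of (fun y => (y == x)%:R) [:: x]) => y.
by rewrite inE; case: (y == x); rewrite ?eqxx.
Qed.

Definition free_basis x : free_module := projT1 (cid (free_basis_exists x)).

Lemma fcoef_basis x y : fcoef (free_basis x) y = (y == x)%:R.
Proof. by rewrite /free_basis; case: cid => u /= ->. Qed.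

Lemma free_sum u (s : seq X) : uniq s -> (forall x, fcoef u x != 0 -> x \in s) ->
  u = \sum_(x <- s) fcoef u x *: free_basis x.
Proof.
move=> us su; apply: fcoefP => y.
have -> : fcoef (\sum_(x <- s) fcoef u x *: free_basis x) y
    = \sum_(x <- s) fcoef u x * (y == x)%:R.
  rewrite -[LHS]/(fcoef_map y _) linear_sum; apply: eq_bigr => x _.
  by rewrite -[LHS]/(fcoef _ y) fcoefZ fcoef_basis.
have [ys|ys] := boolP (y \in s).
  rewrite (bigD1_seq y) //= eqxx mulr1 big1 ?addr0 // => x /negPf.
  by rewrite eq_sym => ->; rewrite mulr0.
rewrite big_seq big1; last first.
  move=> x xs; case: eqP => [yx|]; rewrite ?mulr0 //.
  by rewrite yx xs in ys.
by apply/eqP; apply: contraNT ys => /su.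
Qed.

Lemma sum_support (V : nmodType) (f : X -> V) (s t : seq X) :
  uniq s -> uniq t -> (forall x, f x != 0 -> x \in s) ->
  (forall x, f x != 0 -> x \in t) -> \sum_(x <- s) f x = \sum_(x <- t) f x.
Proof.
have drop0 (r : seq X) : \sum_(x <- r) f x = \sum_(x <- r | f x != 0) f x.
  rewrite [LHS](bigID (fun x => f x != 0)) /= [X in _ + X]big1 ?addr0 //.
  by move=> x; rewrite negbK => /eqP.
move=> us ut fs ft; rewrite drop0 [RHS]drop0 -[LHS]big_filter -[RHS]big_filter.
apply: perm_big.
apply: uniq_perm; rewrite ?filter_uniq // => x; rewrite !mem_filter.
by have [//|/= fx] := boolP (f x == 0); rewrite fs // ft.
Qed.

Lemma free_lift (E : lmodType R) (e : X -> E) :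
  exists f : {linear free_module -> E}, forall x, f (free_basis x) = e x.
Proof.
(* Any duplicate-free list containing the support is allowed, so that two elements can be summed
   over a common list. *)
pose G : set (free_module * E) := [set q | exists2 s : seq X,
  uniq s /\ (forall x, fcoef q.1 x != 0 -> x \in s) &
  q.2 = \sum_(x <- s) fcoef q.1 x *: e x].
have suppZ (u : free_module) (s : seq X) : (forall x, fcoef u x != 0 -> x \in s) ->
    forall x, fcoef u x *: e x != 0 -> x \in s.
  by move=> us x; apply: contraNT => /(contra (us x))/negPn/eqP->; rewrite scale0r.
have [|||f fG] := @linear_of_graph _ free_module E G.
- split; first by exists [::]; rewrite ?big_nil //; split=> // x; rewrite fcoef0 eqxx.
  move=> a [u e1] [v e2] [s [us su] /= ->] [t [ut tv] /= ->].
  have uST : uniq (undup (s ++ t)) := undup_uniq _.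
  have sST x : fcoef u x != 0 -> x \in undup (s ++ t).
    by move=> /su; rewrite mem_undup mem_cat => ->.
  have tST x : fcoef v x != 0 -> x \in undup (s ++ t).
    by move=> /tv; rewrite mem_undup mem_cat orbC => ->.
  exists (undup (s ++ t)); first split=> // x.
    apply: contraNT => xST.
    have /negPn/eqP u0 := contra (sST x) xST.
    have /negPn/eqP v0 := contra (tST x) xST.
    by rewrite fcoefD fcoefZ u0 v0 mulr0 addr0.
  rewrite [LHS]/= (sum_support us uST) ?(sum_support ut uST); try exact: suppZ.
  rewrite scaler_sumr -big_split; apply: eq_bigr => x _.
  by rewrite fcoefD fcoefZ scalerDl scalerA.
- by move=> _ [s _ /= ->]; rewrite big1 // => x _; rewrite fcoef0 scale0r.
- move=> u; have [s us] := fcoef_finite u.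
  exists (\sum_(x <- undup s) fcoef u x *: e x); exists (undup s) => //.
  by split=> [|x /us]; rewrite ?undup_uniq ?mem_undup.
exists f => x; have [s [us su] /= ->] := fG (free_basis x).
rewrite (@sum_support _ _ s [:: x]) //.
- by rewrite big_seq1 fcoef_basis eqxx scale1r.
- exact: suppZ.
- move=> y; rewrite fcoef_basis inE.
  by case: (y == x) => //; rewrite scale0r eqxx.
Qed.

Lemma free_linear_eq (E : lmodType R) (f g : {linear free_module -> E}) :
  (forall x, f (free_basis x) = g (free_basis x)) -> forall u, f u = g u.
Proof.
move=> fg u; have [s us] := fcoef_finite u.
rewrite (@free_sum u (undup s)) ?undup_uniq // => [|x /us]; last first.
  by rewrite mem_undup.
by rewrite !linear_sum; apply: eq_bigr => x _; rewrite !linearZ fg.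
Qed.

Lemma free_projective : projective_module free_module.
Proof.
move=> M N g f g_surj.
have /choice[m gm] : forall x, exists m, g m = f (free_basis x).
  by move=> x; apply: g_surj.
have [h hE] := free_lift m; exists h.
by apply: (@free_linear_eq _ (g \o h) f) => x /=; rewrite hE gm.
Qed.

End FreeModules.

Section FreeCovers.
Variables (R : comNzRingType).

Lemma free_cover_exists (A : lmodType R) :
  exists f : {linear free_module R A -> A}, forall x, f (free_basis R x) = x.
Proof. exact: (@free_lift R A A id). Qed.

Definition free_cover (A : lmodType R) := projT1 (cid (free_cover_exists A)).

Lemma free_cover_basis (A : lmodType R) x : free_cover A (free_basis R x) = x.
Proof. by rewrite /free_cover; case: cid => f /= ->. Qed.

Lemma free_cover_surj A : surjective_map (free_cover A).
Proof. by move=> x; exists (free_basis R x); rewrite free_cover_basis. Qed.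

Lemma projective_section (P : lmodType R) : projective_module P ->
  exists s : {linear P -> free_module R P}, forall x, free_cover P (s x) = x.
Proof. by move=> /(_ _ _ (free_cover P) idfun (@free_cover_surj P)). Qed.

End FreeCovers.

(** * Noetherian local rings *)

Section NoetherianRings.
Variable R : comNzRingType.
Hypothesis R_noetherian : noetherian_ring R.

(** Without a maximal member, choice yields a strictly increasing chain of ideals in [P]. *)
Lemma noetherian_maximal (P : set (set R)) (I0 : set R) :
  (forall I, P I -> ideal I) -> P I0 ->
  exists J, P J /\ forall K, P K -> J `<=` K -> K = J.
Proof.
move=> idP PI0; apply: contrapT => noMax.
have /choice[next nextP] : forall J : {I | P I},
    exists K : {I | P I}, sval J `<=` sval K /\ sval K <> sval J.
  move=> [J PJ]; apply: contrapT => noK; apply: noMax; exists J; split=> // K PK JK.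
  by apply: contrapT => KJ; apply: noK; exists (exist _ K PK).
pose I n := iter n next (exist _ I0 PI0).
have [n|n|N /(_ N.+1 (leqnSn N))] := R_noetherian (I := fun n => sval (I n)).
- exact/idP/(svalP (I n)).
- exact: (nextP (I n)).1.
- exact: (nextP (I N)).2.
Qed.

End NoetherianRings.

(** * Adjoining an element to an ideal; nilpotent ideals *)

Section Ideals.
Variable R : comNzRingType.
Implicit Types I : set R.

Definition adjoin I (x : R) : set R :=
  [set z | exists y r, I y /\ z = y + r * x].

Lemma adjoin_ideal I x : ideal I -> ideal (adjoin I x).
Proof.
case=> I0 ID IM; split; first by exists 0, 0; rewrite mul0r addr0.
- move=> _ _ [y [r [Iy ->]]] [y' [r' [Iy' ->]]].
  exists (y + y'), (r + r'); split; first exact: ID.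
  by rewrite mulrDl addrACA.
- move=> a _ [y [r [Iy ->]]]; exists (a * y), (a * r).
  by split; [apply: IM | rewrite mulrDr mulrA].
Qed.

Lemma sub_adjoin I x : I `<=` adjoin I x.
Proof. by move=> y Iy; exists y, 0; rewrite mul0r addr0. Qed.

Lemma mem_adjoin I x : ideal I -> adjoin I x x.
Proof. by case=> I0 _ _; exists 0, 1; rewrite add0r mul1r. Qed.

Lemma zero_ideal : ideal ([set 0] : set R).
Proof.
split=> //; first by move=> _ _ -> ->; rewrite addr0.
by move=> a _ ->; rewrite mulr0.
Qed.

Lemma principal_ideal (x : R) : ideal [set y | exists r, y = r * x].
Proof.
split; first by exists 0; rewrite mul0r.
- by move=> _ _ [r ->] [s ->]; exists (r + s); rewrite mulrDl.
- by move=> a _ [r ->]; exists (a * r); rewrite mulrA.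
Qed.

Lemma ideal_full I : ideal I -> I 1 -> I = setT.
Proof.
case=> _ _ IM I1; apply/seteqP; split=> // x _.
by rewrite -[x]mulr1; apply: IM.
Qed.

(** For an ideal this is [I^n = 0], stated with lists of factors to allow induction on them. *)
Definition nilpotent_power I (n : nat) : Prop :=
  forall s : seq R, (forall x, x \in s -> I x) -> (n <= size s)%N ->
    \prod_(x <- s) x = 0.

(** In the expansion of a product of [n + k] factors [y + r x], each term has [n] factors from [I]
    or [k] factors [x]. *)
Lemma nilpotent_adjoin I (x : R) n k :
  nilpotent_power I n -> x ^+ k = 0 ->
  nilpotent_power (adjoin I x) (n + k).
Proof.
move=> nilI xk s sI sizes.
(* [t] collects the factors already taken from [I], and [e] counts the factors [x]. *)
suff gen t e : (forall y, y \in t -> I y) -> (n + k <= size s + size t + e)%N ->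
    (\prod_(y <- t) y) * x ^+ e * \prod_(z <- s) z = 0.
  have := gen [::] 0%N; rewrite big_nil !mul1r; apply=> //.
  by rewrite !addn0.
elim: s sI t e {sizes} => [|z s IHs] sI t e tI.
  rewrite add0n big_nil mulr1 => le_nk.
  have [le_n|lt_n] := leqP n (size t); first by rewrite nilI ?mul0r.
  have le_k : (k <= e)%N.
    by rewrite -(leq_add2l n) (leq_trans le_nk) // leq_add2r ltnW.
  by rewrite -(subnK le_k) exprD xk !mulr0.
move=> le_nk; have [y [r [Iy zE]]] := sI z (mem_head _ _).
have sI' z' : z' \in s -> adjoin I x z'.
  by move=> z's; apply: sI; rewrite inE z's orbT.
rewrite big_cons zE mulrDl mulrDr.
have -> : \prod_(y0 <- t) y0 * x ^+ e * (y * \prod_(z0 <- s) z0) =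
    \prod_(y0 <- y :: t) y0 * x ^+ e * \prod_(z0 <- s) z0.
  by rewrite big_cons !mulrA; congr (_ * _); rewrite mulrC mulrA.
have -> : \prod_(y0 <- t) y0 * x ^+ e * (r * x * \prod_(z0 <- s) z0) =
    r * (\prod_(y0 <- t) y0 * x ^+ e.+1 * \prod_(z0 <- s) z0).
  by rewrite exprSr !mulrA; congr (_ * _); rewrite -!mulrA [RHS]mulrCA;
     congr (_ * _); rewrite mulrCA.
rewrite !IHs ?mulr0 ?addr0 //.
- by move=> y'; rewrite inE => /predU1P[->|/tI].
- by move: le_nk; rewrite /= addnS addSn.
- by move: le_nk; rewrite /= addnS !addSn.
Qed.

End Ideals.

(** * Units and nilpotents in a Noetherian local ring *)

Section LocalRings.
Variables (R : comNzRingType) (m : set R).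
Hypotheses (R_local : local_ring m) (R_noetherian : noetherian_ring R).

Lemma maximal_ideal_ideal : ideal m. Proof. by case: R_local => [[]]. Qed.

Lemma maximal_ideal_proper : ~ m 1.
Proof.
case: R_local => [[[_ _ mM] mT _] _] m1; apply: mT; apply/seteqP; split=> // x _.
by rewrite -[x]mulr1; apply: mM.
Qed.

(** For a non-unit [x], an ideal maximal among those containing [x] but not [1] is a maximal ideal,
    hence equal to [m]. *)
Lemma local_unit (x : R) : ~ m x -> exists y, y * x = 1.
Proof.
move=> mx; apply: contrapT => nux.
pose P := [set I : set R | [/\ ideal I, I x & ~ I 1]].
have [||J [[idJ Jx J1] maxJ]] :=
    noetherian_maximal R_noetherian (P := P) (I0 := [set y | exists r, y = r * x]).
- by move=> I [].
- split; first exact: principal_ideal.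
    by exists 1; rewrite mul1r.
  by move=> [r /esym rx1]; apply: nux; exists r.
have maxidJ : maximal_ideal J.
  split=> //; first by move=> JT; apply: J1; rewrite JT.
  move=> K idK JK; have [K1|K1] := pselect (K 1).
    by right; apply: ideal_full.
  by left; apply: maxJ => //; split=> //; apply: JK.
by apply: mx; rewrite -(R_local.2 _ maxidJ).
Qed.

Lemma local_unit_1B (a x : R) : m x -> exists y, y * (1 - a * x) = 1.
Proof.
case: maximal_ideal_ideal => _ mD mM mx; apply: local_unit => m1.
apply: maximal_ideal_proper; rewrite -(subrK (a * x) 1).
by apply: mD => //; apply: mM.
Qed.

(** Adjoining a nilpotent element keeps an ideal nilpotent, so a maximal nilpotent ideal inside [m]
    is all of [m]. *)
Lemma nil_nilpotent :
  (forall x, m x -> exists k, x ^+ k = 0) -> exists n, nilpotent_power m n.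
Proof.
move=> nilm; case: maximal_ideal_ideal => m0 mD mM.
pose P := [set I : set R | [/\ ideal I, I `<=` m & exists n, nilpotent_power I n]].
have [||J [[idJ Jm [n nilJ]] maxJ]] :=
    noetherian_maximal R_noetherian (P := P) (I0 := [set 0]).
- by move=> I [].
- split.
  + exact: zero_ideal.
  + by move=> _ ->.
  + exists 1%N => -[|x s] // xs0 _.
    by rewrite big_cons (xs0 x (mem_head _ _)) mul0r.
suff -> : m = J by exists n.
apply/seteqP; split=> // x mx; have [k xk] := nilm x mx.
rewrite -(maxJ (adjoin J x)); first exact: mem_adjoin.
- split; first exact: adjoin_ideal.
  + by move=> _ [y [r [/Jm my ->]]]; apply: mD => //; apply: mM.
  + by exists (n + k)%N; apply: nilpotent_adjoin.
- exact: sub_adjoin.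
Qed.

(** The chain of ideals [(x^k)] stabilizes, so [x^N = a x^(N+1)] for some [a], and [1 - a x] is a
    unit. *)
Lemma artinian_nil : artinian_ring R ->
  forall x, m x -> exists k, x ^+ k = 0.
Proof.
move=> artR x mx.
have [n|n _ [r ->]|N stab] :=
    artR (fun n => [set y | exists r, y = r * x ^+ n]).
- exact: principal_ideal.
- by exists (r * x); rewrite exprS mulrA.
have : [set y | exists r, y = r * x ^+ N] (x ^+ N) by exists 1; rewrite mul1r.
rewrite -(stab N.+1) // => -[a xN].
have [u ux] := local_unit_1B a mx.
exists N; rewrite -[LHS]mul1r -ux -mulrA mulrBl mul1r -mulrA -exprS -xN.
by rewrite subrr mulr0.
Qed.

End LocalRings.

(** * Local rings with nilpotent maximal ideal *)

Section NilpotentLocalRings.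
Variables (R : comNzRingType) (m : set R) (n : nat).
Hypotheses (R_local : local_ring m) (R_noetherian : noetherian_ring R).
Hypothesis m_nilpotent : nilpotent_power m n.

Let m_ideal := maximal_ideal_ideal R_local.

(** Multiply [x] by elements of [m] as long as the result stays outside [S]; this stops because
    products of [n] of them vanish. For a submodule [S], the element found spans a copy of [R/m]
    modulo [S]. *)
Lemma nilpotent_minimal_step (M : lmodType R) (S : set M) (x : M) : S 0 -> ~ S x ->
  exists r, ~ S (r *: x) /\ forall a, m a -> S (a *: (r *: x)).
Proof.
move=> S0 Sx.
have : forall s : seq R, (forall a, a \in s -> m a) -> (n <= size s)%N ->
    S ((\prod_(a <- s) a) *: x) by move=> s sm ns; rewrite m_nilpotent // scale0r.
elim: n x Sx => [|k IHk] x Sx Sprod.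
  by case: Sx; have := Sprod [::]; rewrite big_nil scale1r; apply.
have [Smx|] := pselect (forall a, m a -> S (a *: x)).
  by exists 1; rewrite scale1r.
move=> /existsNP[a /not_implyP[ma Sax]].
have [|r [Sr mSr]] := IHk (a *: x) Sax.
  move=> s sm ks; have := Sprod (a :: s); rewrite big_cons mulrC -scalerA; apply=> //.
  by move=> b; rewrite inE => /predU1P[->|/sm].
by exists (r * a); rewrite -scalerA.
Qed.

(** A nonzero [s] killed by [m] exists by the previous lemma; elements outside [m] are units and
    cannot kill it. *)
Lemma socle_exists : exists s : R, forall a, a * s = 0 <-> m a.
Proof.
have [s s0 ms] : exists2 s, s <> 0 & forall a, m a -> a * s = 0.
  have [||s [s0 ms]] := @nilpotent_minimal_step R^o [set 0] 1 => //.
    by move/eqP; rewrite oner_eq0.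
  by exists (s * 1).
exists s => a; split=> [as0|/ms //].
apply: contrapT => /(local_unit R_local R_noetherian)[b ba1]; apply: s0.
by rewrite -[LHS]mul1r -ba1 -mulrA as0 mulr0.
Qed.

(** Noetherian induction: take [J] maximal among the ideals above which some descending chain does
    not stabilize, and compare with [J + (z)], where [z] is outside [J] and [m z] inside. *)
Lemma nilpotent_artinian : artinian_ring R.
Proof.
pose artin_over (J : set R) := forall I : nat -> set R,
  (forall k, ideal (I k)) -> (forall k, J `<=` I k) ->
  (forall k, I k.+1 `<=` I k) ->
  exists N, forall k, (N <= k)%N -> I k = I N.
suff art0 : artin_over [set 0].
  by move=> I idI decI; apply: art0 => // k _ ->; have [] := idI k.
apply: contrapT => nart0.
pose P := [set J : set R | ideal J /\ ~ artin_over J].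
have [||J [[idJ nartJ] maxJ]] :=
    noetherian_maximal R_noetherian (P := P) (I0 := [set 0]).
- by move=> I [].
- by split; first exact: zero_ideal.
have [J0 JD JM] := idJ.
apply: nartJ => I idI JI decI.
have decI_le i j : (i <= j)%N -> I j `<=` I i.
  elim: j => [|j IHj]; first by rewrite leqn0 => /eqP->.
  by rewrite leq_eqVlt => /predU1P[->//|/IHj]; apply: subset_trans.
have [J1|nJ1] := pselect (J 1).
  exists 0%N => k _; have I1 i : I i = setT by apply: ideal_full => //; apply: JI.
  by rewrite !I1.
have [z Jz mJz] : exists2 z, ~ J z & forall a, m a -> J (a * z).
  by have [//|//|z [Jz mJz]] := @nilpotent_minimal_step R^o J 1; exists (z * 1).
have artK : artin_over (adjoin J z).
  apply: contrapT => nartK; apply: Jz.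
  rewrite -(maxJ (adjoin J z)); first exact: mem_adjoin.
    by split=> //; apply: adjoin_ideal.
  exact: sub_adjoin.
(* Either the whole chain lies above [J + (z)], or [z] is eventually outside it, and then [I k] is
   determined by [I k + (z)]. *)
have [Iz|/existsNP[N0 IN0z]] := pselect (forall k, I k z).
  apply: artK => // k _ [y [r [/JI Iy ->]]].
  by have [_ ID IM] := idI k; apply: ID => //; apply: IM.
have [k|k|k|N stab] := artK (fun k => adjoin (I k) z).
- exact: adjoin_ideal.
- by move=> _ [y [r [/(JI k) Iy ->]]]; exists y, r.
- by move=> _ [y [r [/(decI k) Iy ->]]]; exists y, r.
exists (maxn N N0) => k; rewrite geq_max => /andP[le_N le_N0].
apply/seteqP; split; first by apply: decI_le; rewrite geq_max le_N.
move=> a Ia; have [_ ID IM] := idI k.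
have [b [r [Ib abr]]] : adjoin (I k) z a.
  by rewrite (stab k le_N) -(stab _ (leq_maxl N N0)); apply: sub_adjoin.
(* Here [a = b + r z]. If [r] were a unit, [z] would lie in [I (maxn N N0)]; so [r] is in [m] and
   [r z] is in [J]. *)
suff mr : m r by rewrite abr; apply: ID => //; apply: JI; apply: mJz.
apply: contrapT => mr; apply: IN0z.
have [u ur] := local_unit R_local R_noetherian mr.
apply: (decI_le _ _ (leq_maxr N N0)); have [_ ID' IM'] := idI (maxn N N0).
rewrite -[z]mul1r -ur -mulrA; apply: (IM').
have -> : r * z = a + (-1) * b by rewrite mulN1r abr addrAC subrr add0r.
apply: ID' => //; apply: IM'.
by apply: (decI_le _ k) => //; rewrite geq_max le_N.
Qed.

End NilpotentLocalRings.

(** * Baer's criterion over a nilpotent maximal ideal *)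

Section Zorn.

(** [Zorn_bigcup] also asks for the union of the empty chain, so the empty set is added to [Q]. If
    it turns out maximal, every member of [Q] is empty and [G0] serves. *)
Lemma Zorn_nonempty_chains (T : Type) (Q : set (set T)) (G0 : set T) : Q G0 ->
  (forall F : set (set T), F `<=` Q -> F !=set0 -> total_on F subset ->
    Q (\bigcup_(X in F) X)) ->
  exists G, Q G /\ forall H, Q H -> G `<=` H -> H `<=` G.
Proof.
move=> QG0 Qchain.
have [F FQ totF|G [QG maxG]] := @Zorn_bigcup T [set X | X = set0 \/ Q X].
  pose F' := F `&` Q.
  have [[X0 F'X0]|noF'] := pselect (F' !=set0).
    have -> : \bigcup_(X in F) X = \bigcup_(X in F') X.
      apply/seteqP; split=> t [X FX Xt]; last by exists X => //; case: FX.
      by exists X => //; split=> //; have [X_0|//] := FQ X FX; rewrite X_0 in Xt.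
    right; apply: Qchain; [by move=> X [] | by exists X0 |].
    by move=> X Y [FX _] [FY _]; apply: totF.
  left; apply/seteqP; split=> // t [X FX Xt].
  have [X_0|QX] := FQ X FX; first by rewrite X_0 in Xt.
  by case: noF'; exists X.
have maxG' H : Q H -> G `<=` H -> H `<=` G.
  move=> QH GH; apply: contrapT => HG.
  by apply: (maxG H (conj GH HG)); right.
case: QG => [G_0|QG]; last by exists G.
exists G0; split=> // H QH _; rewrite G_0 in maxG'.
by move=> t Ht; have := maxG' _ QH (@sub0set _ H) t Ht.
Qed.

End Zorn.

Section LinearRelations.
Variables (R : comNzRingType) (N E : lmodType R).
Implicit Type G : set (N * E).

Definition graph_domain G : set N := [set x | exists e, G (x, e)].

Definition graph_adjoin G (p : N * E) : set (N * E) :=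
  [set q | exists g r, G g /\ q = g + r *: p].

Lemma graph_adjoin_submod G p : submod G -> submod (graph_adjoin G p).
Proof.
move=> subG; split.
  by exists 0, 0; rewrite scale0r addr0; split=> //; apply: submod0.
move=> a _ _ [g [r [Gg ->]]] [g' [r' [Gg' ->]]].
exists (a *: g + g'), (a * r + r'); split; first by case: subG => _; apply.
by rewrite scalerDr scalerDl addrACA scalerA.
Qed.

Lemma sub_graph_adjoin G p : G `<=` graph_adjoin G p.
Proof. by move=> g Gg; exists g, 0; rewrite scale0r addr0. Qed.

Lemma mem_graph_adjoin G p : submod G -> graph_adjoin G p p.
Proof. by move=> /submod0 G0; exists 0, 1; rewrite add0r scale1r. Qed.

Lemma submod_bigcup_chain (M : lmodType R) (F : set (set M)) :
  F !=set0 -> total_on F subset -> (forall S, F S -> submod S) ->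
  submod (\bigcup_(S in F) S).
Proof.
move=> [S FS] totF subF; split; first by exists S => //; apply: (submod0 (subF S FS)).
move=> a x y [X FX Xx] [Y FY Yy]; have [XY|YX] := totF _ _ FX FY.
  by exists Y => //; apply: (subF Y FY).2 => //; apply: XY.
by exists X => //; apply: (subF X FX).2 => //; apply: YX.
Qed.

End LinearRelations.

(** * Extending linear maps one element at a time *)

Section LocalExtension.
Variables (R : comNzRingType) (m : set R).
Hypotheses (R_local : local_ring m) (R_noetherian : noetherian_ring R).

Lemma local_domain_coef (M : lmodType R) (D : set M) r x :
  submod D -> ~ D x -> D (r *: x) -> m r.
Proof.
move=> subD Dx Drx; apply: contrapT => /(local_unit R_local R_noetherian)[u ur].
by apply: Dx; rewrite -[x]scale1r -ur -scalerA; apply: submodZ.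
Qed.

Lemma graph_domain_submod (N E : lmodType R) (G : set (N * E)) :
  submod G -> submod (graph_domain G).
Proof.
move=> subG; split; first by exists 0; apply: (submod0 subG).
move=> a x y [e Gx] [e' Gy]; exists (a *: e + e').
by case: subG => _ /(_ a _ _ Gx Gy).
Qed.

(* If [y + r x = 0] with [y] in the domain and [x] outside of it, then [r] is
   not a unit, so [r (x, c)] already lies in the graph. *)
Lemma graph_adjoin_single_valued (N E : lmodType R) (G : set (N * E)) x c :
  submod G -> single_valued G -> ~ graph_domain G x ->
  (forall a, m a -> G (a *: x, a *: c)) ->
  single_valued (graph_adjoin G (x, c)).
Proof.
move=> subG svG Dx mG e [[y e'] [r [Gy [/esym yrx ->]]]].
have mr : m r.
  apply: (local_domain_coef (graph_domain_submod subG) Dx).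
  have -> : r *: x = (-1) *: y.
    by apply/eqP; rewrite scaleN1r -addr_eq0 addrC; apply/eqP.
  by apply: submodZ; [apply: graph_domain_submod | exists e'].
apply: svG; have : G (y + r *: x, e' + r *: c) := submodD subG Gy (mG r mr).
by rewrite -[y + _]/(y + _) yrx.
Qed.

(* Every linear map from the ideal [m] to [E] (given by a graph [H]) is the
   multiplication by an element of [E]; that is, [Ext^1(R/m, E) = 0]. *)
Definition max_injective (E : lmodType R) : Prop :=
  forall H : set (R^o * E), submod H -> single_valued H ->
    (forall a, m a -> graph_domain H a) ->
    exists c, forall a : R^o, m a -> H (a, a *: c).

Lemma injective_max_injective (E : lmodType R) :
  injective_module E -> max_injective E.
Proof.
move=> injE H subH svH mH; have [f fE] := injective_extend injE subH svH.
exists (f 1) => a /mH[e Ha]; rewrite -linearZ /= [a *: _]mulr1.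
by rewrite (fE _ _ Ha).
Qed.

Variable n : nat.
Hypothesis m_nilpotent : nilpotent_power m n.

(** Baer's argument for a maximal extension: if its domain is not [N], some [r x] outside has
    [m r x] inside. The map sending [a] in [m] to the value at [a r x] is multiplication by some
    [c], and [(r x, c)] can be adjoined. *)
Lemma max_injective_extend (N E : lmodType R) (G : set (N * E)) :
  max_injective E -> submod G -> single_valued G ->
  exists f : {linear N -> E}, forall x e, G (x, e) -> f x = e.
Proof.
move=> injE subG svG.
have [|F FQ [X0 FX0] totF|G1 [[subG1 svG1 GG1] maxG1]] :=
  @Zorn_nonempty_chains _ [set X | [/\ submod X, single_valued X & G `<=` X]] G.
- by split.
- split.
  + apply: submod_bigcup_chain => //; first by exists X0.
    by move=> S /FQ[].
  + by move=> e [X /FQ[_ svX _] /svX].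
  + by move=> g Gg; exists X0 => //; have [_ _] := FQ _ FX0; apply.
suff dom x : graph_domain G1 x.
  have [f fG1] := linear_of_graph subG1 svG1 dom; exists f => x e /GG1 G1x.
  exact: (single_valued_eq subG1 svG1 (fG1 x)).
apply: contrapT => Dx.
have subD := graph_domain_submod subG1.
have [r [Drx mrx]] := nilpotent_minimal_step m_nilpotent (submod0 subD) Dx.
have [|||c mc] := injE [set q | G1 (q.1 *: (r *: x), q.2)].
- split; first by rewrite /= scale0r; apply: (submod0 subG1).
  move=> a [b e] [b' e'] /= Gb Gb'.
  have : G1 (a *: (b *: (r *: x)) + b' *: (r *: x), a *: e + e') :=
    subG1.2 a _ _ Gb Gb'.
  by rewrite [a *: (_ *: _)]scalerA -scalerDl.
- by move=> e /=; rewrite scale0r; apply: svG1.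
- by move=> a ma; apply: mrx.
case: (Drx); exists c; apply: (maxG1 (graph_adjoin G1 (r *: x, c))).
- split; first exact: graph_adjoin_submod.
    exact: graph_adjoin_single_valued subG1 svG1 Drx mc.
  by apply: subset_trans GG1 _; apply: sub_graph_adjoin.
- exact: sub_graph_adjoin.
- exact: mem_graph_adjoin.
Qed.

Lemma max_injective_injective (E : lmodType R) :
  max_injective E -> injective_module E.
Proof.
move=> injE M N i f inj_i.
have [||h hE] := @max_injective_extend N E [set q | exists x, q = (i x, f x)] injE.
- split; first by exists 0; rewrite !linear0.
  by move=> a _ _ [x ->] [y ->]; exists (a *: x + y); rewrite !linearP.
- move=> _ [x [/esym ix0 ->]].
  by rewrite (inj_i x 0) ?linear0 // ix0 linear0.
- by exists h => x; apply: hE; exists x.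
Qed.

(** Asking only for a retraction covers direct summands, such as projective modules in free ones. *)
Lemma injective_iso (E E' : lmodType R) (f : {linear E -> E'})
    (g : {linear E' -> E}) :
  cancel f g -> injective_module E' -> injective_module E.
Proof.
move=> fK injE' M N i h inj_i; have [l lE] := injE' M N i (f \o h) inj_i.
by exists (g \o l) => x /=; rewrite lE /= fK.
Qed.

End LocalExtension.

(** * Artinian local rings of finite self-injective dimension *)

Section Kernels.
Variables (R : comNzRingType) (A B : lmodType R) (f : {linear A -> B}).

Lemma kernel_submod : submod [set x | f x = 0].
Proof.
split; first exact: linear0.
by move=> a x y /= fx fy; rewrite linearP fx fy scaler0 addr0.
Qed.

Definition kernel : lmodType R := submodule kernel_submod.
Definition kernel_incl : {linear kernel -> A} := submodule_incl kernel_submod.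

Lemma kernel_incl_inj : injective kernel_incl.
Proof. exact: submodule_incl_inj. Qed.

Lemma kernel_inclP x : f (kernel_incl x) = 0.
Proof. exact: (submodule_inclP x). Qed.

Lemma kernel_incl_onto x : f x = 0 -> exists y, kernel_incl y = x.
Proof. exact: submodule_incl_onto. Qed.

End Kernels.

(** * Cokernels and splicing of exact sequences *)

Section Exactness.
Variable R : comNzRingType.

Lemma image_submod (A B : lmodType R) (f : {linear A -> B}) :
  submod [set y | exists x, y = f x].
Proof.
split; first by exists 0; rewrite linear0.
by move=> a _ _ [x ->] [x' ->]; exists (a *: x + x'); rewrite linearP.
Qed.

Definition cokernel (A B : lmodType R) (f : {linear A -> B}) : lmodType R :=
  quotient (image_submod f).

Definition cokernel_map (A B : lmodType R) (f : {linear A -> B}) :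
  {linear B -> cokernel f} := quotient_map (image_submod f).

Lemma exact_splice (A1 A2 A3 B1 B2 : lmodType R) (p1 : {linear A1 -> B1})
    (i1 : {linear B1 -> A2}) (p2 : {linear A2 -> B2}) (i2 : {linear B2 -> A3}) :
  surjective_map p1 -> exact_at i1 p2 -> injective i2 ->
  exact_at (i1 \o p1) (i2 \o p2).
Proof.
move=> p1_surj ex i2_inj y /=.
have -> : i2 (p2 y) = 0 <-> p2 y = 0.
  by split=> [i20|->]; [apply: i2_inj; rewrite linear0 | rewrite linear0].
split=> [/ex[b ->]|[a ->]]; last by apply/ex; exists (p1 a).
by have [a <-] := p1_surj b; exists a.
Qed.

Lemma kernel_exact (B C : lmodType R) (f : {linear B -> C}) :
  exact_at (kernel_incl f) f.
Proof.
move=> y; split=> [/(kernel_incl_onto (f := f))[x <-]|[x ->]].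
  by exists x.
exact: kernel_inclP.
Qed.

Lemma cokernel_exact (B C : lmodType R) (f : {linear B -> C}) :
  exact_at f (cokernel_map f).
Proof. by move=> y; apply: quotient_map_eq0. Qed.

End Exactness.

(** * Finite injective dimension, and embeddings into free modules *)

Section SelfInjective.
Variables (R : comNzRingType) (m : set R) (n : nat).
Hypotheses (R_local : local_ring m) (R_noetherian : noetherian_ring R).
Hypothesis m_nilpotent : nilpotent_power m n.

(* With [s] a generator of a copy of [R/m] in [R]: an element [y] of the
   injective module [ker g] killed by [m] is [s z] for some [z] in [ker g], so it
   lifts along [f] to an element still killed by [m]; hence
   [Ext^1(R/m, ker f) = 0]. *)
Lemma injective_kernel (A B C : lmodType R) (f : {linear A -> B})
    (g : {linear B -> C}) :
  exact_at f g -> injective_module A -> injective_module (kernel g) ->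
  injective_module (kernel f).
Proof.
move=> ex_fg injA injK.
apply: (max_injective_injective R_local R_noetherian m_nilpotent).
move=> H subH svH mH; pose i := kernel_incl f.
(* The given map from [m] to [ker f], seen in the injective module [A], is multiplication by some
   [e]. *)
have [|||e He] := injective_max_injective (m := m) injA
    (H := [set q | exists x, q.2 = i x /\ H (q.1, x)]).
- split; first by exists 0; rewrite linear0; split=> //; apply: (submod0 subH).
  move=> a [b _] [b' _] [x [/= -> Hx]] [x' [/= -> Hx']].
  exists (a *: x + x'); rewrite linearP; split=> //.
  by case: subH => _ /(_ a _ _ Hx Hx').
- by move=> _ [x [/= -> /svH->]]; rewrite linear0.
- by move=> a /mH[x Hx]; exists (i x), x.
have [y yE] : exists y, kernel_incl g y = f e.
  by apply: kernel_incl_onto; apply/ex_fg; exists e.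
have my a : m a -> a *: y = 0.
  move=> /He[x [/= ae _]]; apply: (@kernel_incl_inj _ _ _ g).
  by rewrite linear0 linearZ yE -linearZ ae kernel_inclP.
have [s sP] := socle_exists R_local R_noetherian m_nilpotent.
(* By the choice of [s], the map [r s |-> r y] is well defined; extended to [R], its value [h 1]
   satisfies [s (h 1) = y]. *)
have [||h hE] := @injective_extend _ (R^o : lmodType R) _
    [set q | exists r : R, q = (r * s, r *: y)] injK.
- split; first by exists 0; rewrite mul0r scale0r.
  move=> a _ _ [r ->] [r' ->]; exists (a * r + r').
  by rewrite mulrDl scalerDl -mulrA -scalerA.
- by move=> _ [r [/esym/sP/my ry ->]].
have sh : s *: h 1 = y.
  rewrite -linearZ (hE _ y) //; exists 1.
  by rewrite mul1r scale1r [s *: _]mulr1.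
have [z fz] : exists z, kernel_incl g (h 1) = f z.
  by apply/ex_fg; apply: kernel_inclP.
(* Subtracting [s z] moves [e] into [ker f] without changing its products with elements of [m]. *)
have [c cE] : exists c, i c = e - s *: z.
  apply: kernel_incl_onto.
  by rewrite linearB linearZ -fz -linearZ sh yE subrr.
exists c => a ma; have [x [/= ae Hx]] := He a ma.
suff -> : a *: c = x by [].
apply: (@kernel_incl_inj _ _ _ f).
rewrite linearZ /= -[kernel_incl f c]/(i c) cE scalerBr scalerA.
by have /sP -> := ma; rewrite scale0r subr0 ae.
Qed.

(** Descend along the resolution: injectivity passes from the kernel in one degree to the one
    before, down to degree 0, where the kernel is isomorphic to [A]. *)
Lemma finite_injdim_injective (A : lmodType R) d :
  injdim_le A d -> injective_module A.
Proof.
move=> [I Id].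
have injK k : (k <= d.+1)%N -> injective_module (kernel (ires_diff I (d.+1 - k))).
  elim: k => [_|k IHk le_kd].
    (* The descent starts with a kernel inside the term of degree [d + 1], which is zero. *)
    rewrite subn0 => M N i f _; exists \0 => x.
    apply: kernel_incl_inj; rewrite [LHS]linear0.
    by rewrite (Id d.+1 (ltnSn d) (kernel_incl _ (f x))).
  have := IHk (ltnW le_kd); rewrite subSn // => injK.
  by apply: injective_kernel injK; [exact: ires_exactS | exact: ires_inj].
have := injK d.+1 (leqnn _); rewrite subnn => inj0.
have ex0 := @ires_exact0 _ _ I.
have [|||f fG] := @linear_of_graph _ A (kernel (ires_diff I 0%N))
    [set q | kernel_incl _ q.2 = ires_coaug I q.1].
- split; first by rewrite /= !linear0.
  by move=> a [x y] [x' y'] /= e e'; rewrite !linearP e e'.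
- by move=> y /= y0; apply: kernel_incl_inj; rewrite y0 !linear0.
- move=> x; have [|y yE] :=
      @kernel_incl_onto _ _ _ (ires_diff I 0%N) (ires_coaug I x).
    by apply/ex0; exists x.
  by exists y.
have [|||g gG] := @linear_of_graph _ (kernel (ires_diff I 0%N)) A
    [set q | kernel_incl _ q.1 = ires_coaug I q.2].
- split; first by rewrite /= !linear0.
  by move=> a [x y] [x' y'] /= e e'; rewrite !linearP e e'.
- by move=> y /= /esym y0; apply: (ires_coaug_inj (i := I)); rewrite y0 !linear0.
- by move=> y; have /ex0[x xE] := kernel_inclP y; exists x.
apply: (injective_iso (f := f) (g := g)) inj0 => x.
by apply: (ires_coaug_inj (i := I)); rewrite -(gG (f x)) (fG x).
Qed.

Hypothesis R_injective : injective_module (R^o : lmodType R).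

(** Since [R] is Noetherian, the values of a map from [m] are supported in one finite set [U]; the
    coordinates in [U] are handled by injectivity of [R]. *)
Lemma free_injective (X : choiceType) : injective_module (free_module R X).
Proof.
apply: (max_injective_injective R_local R_noetherian m_nilpotent).
move=> H subH svH mH.
have [m0 mD mM] := maximal_ideal_ideal R_local.
pose J (U : seq X) := [set a : R | m a /\ exists e, H (a : R^o, e) /\
  forall x, fcoef e x != 0 -> x \in U].
have idJ U : ideal (J U).
  split.
  - by split=> //; exists 0; split=> [|x]; [apply: (submod0 subH) | rewrite fcoef0 eqxx].
  - move=> a b [ma [e [He Ue]]] [mb [e' [He' Ue']]]; split; first exact: mD.
    exists (e + e'); split; first exact: (submodD subH He He').
    move=> x; apply: contraNT => xU; rewrite fcoefD.
    have /negPn/eqP-> := contra (Ue x) xU.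
    by have /negPn/eqP-> := contra (Ue' x) xU; rewrite addr0.
  - move=> a b [mb [e [He Ue]]]; split; first exact: mM.
    exists (a *: e); split; first exact: (submodZ subH a He).
    move=> x; rewrite fcoefZ => /negP aex; apply: Ue; apply/negP => /eqP ex0.
    by apply: aex; rewrite ex0 mulr0.
(* A maximal [J U] is all of [m]: enlarging [U] by the support of one more value does not enlarge
   [J U]. *)
have [||_ [[U ->] maxU]] := noetherian_maximal R_noetherian
    (P := [set K | exists U, K = J U]) (I0 := J [::]).
- by move=> _ [U ->].
- by exists [::].
have mU a : m a -> J U a.
  move=> ma; have [e He] := mH a ma; have [V Ve] := fcoef_finite e.
  rewrite -(maxU (J (U ++ V))); last 2 first.
  - by exists (U ++ V).
  - move=> b [mb [e' [He' Ue']]]; split=> //; exists e'; split=> // x /Ue'.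
    by rewrite mem_cat => ->.
  by split=> //; exists e; split=> // x /Ve; rewrite mem_cat orbC => ->.
have /choice[c cP] : forall x, exists c : R^o, forall a : R^o, m a ->
    exists e, H (a, e) /\ a *: c = fcoef e x.
  move=> x.
  have [|||c cP] := injective_max_injective (m := m) R_injective
      (H := [set q | exists e, H (q.1, e) /\ q.2 = fcoef e x]).
  - split; first by exists 0; rewrite fcoef0; split=> //; apply: (submod0 subH).
    move=> a [b _] [b' _] [e [/= He ->]] [e' [/= He' ->]].
    exists (a *: e + e'); rewrite fcoefD fcoefZ; split=> //.
    by case: subH => _ /(_ a _ _ He He').
  - by move=> _ [e [/= /svH-> ->]]; rewrite fcoef0.
  - by move=> a /mH[e He]; exists (fcoef e x), e.
  by exists c => a /cP[e [/= He ec]]; exists e.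
have [|u uE] := @free_module_of R X (fun x => if x \in U then c x else 0) U.
  by move=> x; case: ifP => // _; rewrite eqxx.
exists u => a /[dup] ma /mU[_ [e [He Ue]]].
suff -> : a *: u = e by [].
apply: fcoefP => x; rewrite fcoefZ uE; case: ifPn => xU; last first.
  by rewrite mulr0; have /negPn/eqP-> := contra (Ue x) xU.
have [e' [He' ae']] := cP x a ma.
by rewrite -[LHS]/(a *: c x) ae' (single_valued_eq subH svH He He').
Qed.

Lemma projective_injective (P : lmodType R) :
  projective_module P -> injective_module P.
Proof.
move=> projP; have [s sK] := projective_section projP.
exact: (injective_iso (f := s) (g := free_cover P) sK (@free_injective P)).
Qed.

(* A partial embedding of [A] into the free module on [A], whose values are
   supported in its domain, extends to one more element [x] with [m x] in the
   domain: extend it linearly by injectivity, and add a socle multiple of the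
   basis vector [x] to keep it injective. *)
Lemma free_embedding (A : lmodType R) :
  exists f : {linear A -> free_module R A}, injective f.
Proof.
(* The last clause keeps basis vectors outside the domain fresh: no value has a nonzero coordinate
   there. *)
pose Q (G : set (A * free_module R A)) := [/\ submod G, single_valued G,
  (forall x, G (x, 0) -> x = 0) &
  (forall x u y, G (x, u) -> fcoef u y != 0 -> graph_domain G y)].
have [|F FQ [X0 FX0] totF|G [[subG svG injG suppG] maxG]] :=
    @Zorn_nonempty_chains _ Q [set 0].
- split.
  + by split=> // a _ _ -> ->; rewrite scaler0 addr0.
  + by move=> _ [->].
  + by move=> _ [->].
  + by move=> _ _ y [_ ->]; rewrite fcoef0 eqxx.
- split.
  + apply: submod_bigcup_chain => //; first by exists X0.
    by move=> S /FQ[].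
  + by move=> e [X /FQ[_ svX _ _] /svX].
  + by move=> x [X /FQ[_ _ injX _] /injX].
  + move=> x u y [X FX Xu] uy; have [_ _ _ suppX] := FQ X FX.
    by have [v Xv] := suppX _ _ _ Xu uy; exists v, X.
have subD := graph_domain_submod subG.
suff dom x : graph_domain G x.
  have [f fG] := linear_of_graph subG svG dom; exists f => x y fxy.
  apply/eqP; rewrite -subr_eq0; apply/eqP/injG.
  have : G (x - y, f x - f y) := submodB subG (fG x) (fG y).
  by rewrite fxy subrr.
apply: contrapT => Dx0.
have [r0 [Dx mx]] := nilpotent_minimal_step m_nilpotent (submod0 subD) Dx0.
move: (r0 *: x) Dx mx => {Dx0 r0} x0 Dx mx.
have [|||c0 Gc0] := injective_max_injective (m := m) (@free_injective A)
    (H := [set q | G (q.1 *: x0, q.2)]).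
- split; first by rewrite /= scale0r; apply: (submod0 subG).
  move=> a [b e] [b' e'] /= Gb Gb'.
  have : G (a *: (b *: x0) + b' *: x0, a *: e + e') := subG.2 a _ _ Gb Gb'.
  by rewrite [a *: (_ *: _)]scalerA -scalerDl.
- by move=> e /=; rewrite scale0r; apply: svG.
- by move=> a /mx.
have [U Uc0] := fcoef_finite c0.
(* Drop the coordinates of [c0] outside the domain. For [a] in [m] those of [a c0] vanish already,
   [a c0] being a value of [G]. *)
have [|c1 c1E] := @free_module_of R A
    (fun y => if `[< graph_domain G y >] then fcoef c0 y else 0) U.
  by move=> y; case: ifP => [_ /Uc0|_]; rewrite ?eqxx.
have Gc1 a : m a -> G (a *: x0, a *: c1).
  move=> ma; have /= Gac := Gc0 a ma; suff -> : a *: c1 = a *: c0 by [].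
  apply: fcoefP => y; rewrite !fcoefZ c1E.
  case: ifPn => // /asboolPn Dy; rewrite mulr0; apply/esym/eqP.
  by apply: contra_notT Dy => ac0; apply: (suppG _ _ y Gac); rewrite fcoefZ.
have [s sP] := socle_exists R_local R_noetherian m_nilpotent.
pose c := c1 + s *: free_basis R x0.
have Gc a : m a -> G (a *: x0, a *: c).
  by move=> ma; rewrite /c scalerDr scalerA (sP a).2 // scale0r addr0; apply: Gc1.
pose G' := graph_adjoin G (x0, c).
have subG' : submod G' by apply: graph_adjoin_submod.
have domG' y : graph_domain G y -> graph_domain G' y.
  by move=> [e Gy]; exists e; apply: sub_graph_adjoin.
have domG'x : graph_domain G' x0 by exists c; apply: mem_graph_adjoin.
suff QG' : Q G'.
  apply: Dx; exists c; apply: (maxG G' QG'); first exact: sub_graph_adjoin.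
  exact: mem_graph_adjoin.
split=> //.
- exact: (graph_adjoin_single_valued R_local R_noetherian subG svG Dx Gc).
- move=> z [[y u] [r [Gy zE]]].
  have -> : z = y + r *: x0 := congr1 fst zE.
  have urc : u + r *: c = 0 := esym (congr1 snd zE).
  have : fcoef (u + r *: c) x0 = 0 by rewrite urc fcoef0.
  have u0 : fcoef u x0 = 0.
    by apply/eqP; apply: contra_notT Dx; apply: suppG Gy.
  have c10 : fcoef c1 x0 = 0 by rewrite c1E; case: ifP => // /asboolP.
  (* The coordinate of [u + r c] at [x0] is [r s]; its vanishing puts [r] in [m], so [r x0] is in
     the domain of [G]. *)
  rewrite fcoefD fcoefZ fcoefD fcoefZ fcoef_basis eqxx mulr1 u0 c10 !add0r => /sP mr.
  apply: injG; rewrite -[X in G (_, X)]urc.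
  exact: (submodD subG Gy (Gc r mr)).
- move=> z v y [[y' u] [r [Gy zE]]].
  have -> : v = u + r *: c := congr1 snd zE; rewrite fcoefD.
  have [->|yx0] := eqVneq y x0; first by [].
  have [Dy|Dy] := pselect (graph_domain G y); first by move=> _; apply: domG'.
  have u0 : fcoef u y = 0 by apply/eqP; apply: contra_notT Dy; apply: suppG Gy.
  rewrite u0 fcoefZ fcoefD fcoefZ fcoef_basis (negPf yx0) mulr0 c1E.
  by rewrite (asboolF Dy) addr0 mulr0 addr0 eqxx.
Qed.

End SelfInjective.

(** * Complete resolutions *)

Section ComplexOfSuccessor.
Variables (R : comNzRingType) (C : int -> lmodType R) (next : int -> int).
Hypothesis nextE : forall i, next i = i + 1.
Variable d : forall i, {linear C i -> C (next i)}.

(** Differentials defined by cases on the degree naturally end in [next i]; they are transported to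
    the [i + 1] that [complex] requires. *)
Definition cast_linear (A : lmodType R) (j k : int) (jk : j = k)
    (f : {linear A -> C j}) : {linear A -> C k} :=
  eq_rect j (fun l => {linear A -> C l}) f k jk.

Hypothesis d_exact : forall i, exact_at (d i) (d (next i)).

Definition successor_diff i : {linear C i -> C (i + 1)} :=
  cast_linear (nextE i) (d i).

(** Once both index equalities are generalized, eliminating them turns the transports into
    identities. *)
Lemma successor_exact i :
  exact_at (successor_diff i) (successor_diff (i + 1)).
Proof.
rewrite /successor_diff; move: (nextE i) (nextE (i + 1)).
by case: (i + 1) / => ij; case: _ / ij; apply: d_exact.
Qed.

Lemma successor_diffK i x : successor_diff (i + 1) (successor_diff i x) = 0.
Proof. by apply/(successor_exact (i := i)); exists x. Qed.

Definition successor_complex : complex R := Complex successor_diffK.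

End ComplexOfSuccessor.

(** * Rings whose projectives are injective and whose modules embed in free ones *)

Section QuasiFrobenius.
Variable R : comNzRingType.
Hypothesis projective_injective :
  forall P : lmodType R, projective_module P -> injective_module P.
Hypothesis free_embedding : forall A : lmodType R,
  exists f : {linear A -> free_module R A}, injective f.

(** A cocycle kills the image of one differential, so by exactness it extends along the next. *)
Lemma injective_left_perp (E A : lmodType R) :
  injective_module E -> left_perp E A.
Proof.
move=> injE [//|n] _ P f f_cocycle.
exact: (exact_extend injE (@pres_exactS _ _ P n) f_cocycle).
Qed.

Definition embedding (A : lmodType R) : {linear A -> free_module R A} :=
  sval (cid (free_embedding A)).

Lemma embedding_inj A : injective (embedding A).
Proof. exact: svalP (cid (free_embedding A)). Qed.

Variable A : lmodType R.

Fixpoint syzygy n : lmodType R :=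
  if n is k.+1 then kernel (free_cover (syzygy k)) else A.

Fixpoint cosyzygy n : lmodType R :=
  if n is k.+1 then cokernel (embedding (cosyzygy k)) else A.

(** Degree 0 covers [A] and degree 1 is the free module containing [A], that is, [cosyzygy 0]; thus
    [A] is the cokernel in degree 0. *)
Definition complete_obj (i : int) : lmodType R :=
  match i with
  | Posz 0 => free_module R A
  | Posz n.+1 => free_module R (cosyzygy n)
  | Negz n => free_module R (syzygy n.+1)
  end.

Definition complete_next (i : int) : int :=
  match i with
  | Posz n => Posz n.+1
  | Negz 0 => Posz 0
  | Negz n.+1 => Negz n
  end.

Lemma complete_nextE i : complete_next i = i + 1.
Proof.
case: i => [n|[|n]] //=; first by rewrite -addn1 PoszD.
by rewrite !NegzE -[n.+2]addn1 PoszD opprD addrNK.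
Qed.

Definition complete_diff (i : int) :
    {linear complete_obj i -> complete_obj (complete_next i)} :=
  match i with
  | Posz 0 => embedding A \o free_cover A
  | Posz n.+1 => embedding (cosyzygy n.+1) \o cokernel_map (embedding (cosyzygy n))
  | Negz 0 => kernel_incl (free_cover A) \o free_cover (syzygy 1)
  | Negz n.+1 =>
      kernel_incl (free_cover (syzygy n.+1)) \o free_cover (syzygy n.+2)
  end.

Lemma complete_exact i :
  exact_at (complete_diff i) (complete_diff (complete_next i)).
Proof.
case: i => [[|n]|[|[|n]]].
- exact: (exact_splice (@free_cover_surj _ A)
    (@cokernel_exact _ _ _ (embedding A)) (@embedding_inj (cosyzygy 1))).
- exact: (exact_splice (@quotient_map_surj _ _ _ _)
    (@cokernel_exact _ _ _ (embedding (cosyzygy n.+1)))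
    (@embedding_inj (cosyzygy n.+2))).
- exact: (exact_splice (@free_cover_surj _ (syzygy 1))
    (@kernel_exact _ _ _ (free_cover A)) (@embedding_inj A)).
- exact: (exact_splice (@free_cover_surj _ (syzygy 2))
    (@kernel_exact _ _ _ (free_cover (syzygy 1)))
    (@kernel_incl_inj _ _ _ (free_cover A))).
- exact: (exact_splice (@free_cover_surj _ (syzygy n.+3))
    (@kernel_exact _ _ _ (free_cover (syzygy n.+2)))
    (@kernel_incl_inj _ _ _ (free_cover (syzygy n.+1)))).
Qed.

Lemma quasi_frobenius_gorenstein_projective : gorenstein_projective A.
Proof.
exists (successor_complex complete_nextE complete_exact).
  split=> [i|i|Q /projective_injective injQ i f].
  - by case: i => [[|n]|n]; apply: free_projective.
  - exact: (@successor_exact _ _ _ complete_nextE _ complete_exact).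
  - split=> [|[g gE] x]; last first.
      by rewrite gE cplx_diffK linear0.
    by apply: (exact_extend injQ);
        apply: (@successor_exact _ _ _ complete_nextE _ complete_exact).
exists (free_cover A); split; first exact: free_cover_surj.
rewrite /= /successor_diff.
(* Equality proofs in [int] are unique, so the transport in degree -1 is the identity. *)
have -> : complete_nextE (-1) = erefl :> (Posz 0 = Posz 0) by apply: eq_axiomK.
move=> y /=; rewrite (@kernel_exact _ _ _ (free_cover A) y).
split=> [[b ->]|[a ->]]; last by exists (free_cover _ a).
by have [a <-] := free_cover_surj b; exists a.
Qed.

End QuasiFrobenius.

(** * The localization as a cokernel *)

Section ShortResolution.
Variable R : comNzRingType.
Implicit Types A B F : lmodType R.

Lemma pres_diffK A (P : projective_resolution A) k (q : P k.+2) :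
  pres_diff P k (pres_diff P k.+1 q) = 0.
Proof. by apply/(@pres_exactS _ _ P k); exists q. Qed.

Lemma pres_augK A (P : projective_resolution A) (q : P 1%N) :
  pres_aug P (pres_diff P 0 q) = 0.
Proof. by apply/(@pres_exact0 _ _ P); exists q. Qed.

(** A partial contraction propagates upwards: [id - w d] lands in the kernel of [d], and a lift of
    it through the next differential is the next contraction. *)
Lemma split_diff_step A (P : projective_resolution A) k
    (w : {linear P k -> P k.+1}) :
  (forall q, pres_diff P k (w (pres_diff P k q)) = pres_diff P k q) ->
  exists w' : {linear P k.+1 -> P k.+2}, forall q,
    pres_diff P k.+1 (w' (pres_diff P k.+1 q)) = pres_diff P k.+1 q.
Proof.
move=> wE.
have [|w' w'E] := @exact_lift _ _ _ _ _ _ _ (idfun \- (w \o pres_diff P k))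
    (@pres_proj _ _ P k.+1) (@pres_exactS _ _ P k).
  by move=> q /=; rewrite linearB /= wE subrr.
by exists w' => q; rewrite w'E /= pres_diffK linear0 subr0.
Qed.

(** Compare an arbitrary resolution [P] with [0 -> F1 -> F0]: [(u, z)] and [(v, s)] are chain maps,
    and [(w, W)] is a homotopy from the identity of [P] to their composite. *)
Lemma short_resolution_left_perp F1 F0 B (d : {linear F1 -> F0}) :
  projective_module F1 -> projective_module F0 -> injective d ->
  (forall f : {linear F1 -> B}, exists g : {linear F0 -> B},
    forall q, f q = g (d q)) ->
  left_perp B (cokernel d).
Proof.
move=> proj1 proj0 d_inj extB n n_gt0 P.
pose d0 := pres_diff P 0; pose d1 := pres_diff P 1.
have [p p_surj p_exact] :
    exists2 p : {linear F0 -> cokernel d}, surjective_map p & exact_at d p.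
  exists (cokernel_map d); [exact: quotient_map_surj | exact: cokernel_exact].
have pd q : p (d q) = 0 by apply/p_exact; exists q.
have [u uE] : exists u : {linear F0 -> P 0%N}, forall q, pres_aug P (u q) = p q.
  by apply: projective_lift => // q; apply: (@pres_aug_surj _ _ P).
have [v vE] : exists v : {linear P 0%N -> F0}, forall q, p (v q) = pres_aug P q.
  by apply: projective_lift; [exact: (@pres_proj _ _ P 0%N) | by []].
have [w wE] : exists w : {linear P 0%N -> P 1%N}, forall q, d0 (w q) = q - u (v q).
  apply: (exact_lift (h := idfun \- (u \o v)) (@pres_proj _ _ P 0)
    (@pres_exact0 _ _ P)).
  by move=> q /=; rewrite linearB /= uE vE subrr.
have [z zE] : exists z : {linear F1 -> P 1%N}, forall q, d0 (z q) = u (d q).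
  apply: (exact_lift (h := u \o d) proj1 (@pres_exact0 _ _ P)) => q /=.
  by rewrite uE pd.
have [s sE] : exists s : {linear P 1%N -> F1}, forall q, d (s q) = v (d0 q).
  apply: (exact_lift (h := v \o d0) (@pres_proj _ _ P 1) p_exact).
  by move=> q /=; rewrite vE pres_augK.
have sd1 q : s (d1 q) = 0.
  by apply: d_inj; rewrite sE pres_diffK !linear0.
have [W WE] : exists W : {linear P 1%N -> P 2%N},
    forall q, d1 (W q) = q - w (d0 q) - z (s q).
  apply: (exact_lift (h := (idfun \- (w \o d0)) \- (z \o s)) (@pres_proj _ _ P 1)
    (@pres_exactS _ _ P 0)) => q /=.
  by rewrite !linearB /= wE zE sE opprB [X in X - _]addrC subrK subrr.
case: n n_gt0 => [//|[|n]] _ f f_cocycle.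
  (* In degree 1, [f - f w d0 - f z s = f d1 W = 0], and [f z = h d] turns [f z s] into [h v d0]. *)
  have [h hE] := extB (f \o z).
  exists ((f \o w) \+ (h \o v)) => q /=.
  rewrite -sE -hE /= -linearD /=; apply/eqP; rewrite -subr_eq0 -linearB opprD addrA.
  by rewrite -WE; apply/eqP/f_cocycle.
(* In higher degrees [W] starts the contraction since [s d1 = 0]. The cocycle [f] kills
   [q - wn (d q)], a cycle and hence a boundary. *)
have [wn wnE] : exists wn : {linear P n.+1 -> P n.+2}, forall q,
    pres_diff P n.+1 (wn (pres_diff P n.+1 q)) = pres_diff P n.+1 q.
  elim: n {f f_cocycle} => [|n [wn wnE]]; last exact: split_diff_step wnE.
  by exists W => q; rewrite WE pres_diffK linear0 subr0 sd1 linear0 subr0.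
exists (f \o wn) => q /=; apply/eqP; rewrite -subr_eq0 -linearB.
have /(@pres_exactS _ _ P n.+1)[t ->] :
    pres_diff P n.+1 (q - wn (pres_diff P n.+1 q)) = 0.
  by rewrite linearB wnE subrr.
by apply/eqP/f_cocycle.
Qed.

End ShortResolution.

(** * [R[X]] as the free module on the powers of [X], and the map [1 - x X] *)

Section PolynomialModule.
Variable R : comNzRingType.

Lemma poly_module_lift (E : lmodType R) (e : nat -> E) :
  exists f : {linear {poly R} -> E}, forall k, f 'X^k = e k.
Proof.
pose f (p : {poly R}) := \sum_(i < size p) p`_i *: e i.
have fE (p : {poly R}) k : (size p <= k)%N -> f p = \sum_(i < k) p`_i *: e i.
  move=> le_pk; rewrite /f (big_ord_widen k (fun i => p`_i *: e i) le_pk).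
  rewrite big_mkcond; apply: eq_bigr => i _; case: ltnP => // le_pi.
  by rewrite nth_default ?scale0r.
have lin_f : linear f.
  move=> a p q; pose k := maxn (size (a *: p + q)) (maxn (size p) (size q)).
  rewrite (fE _ k) ?(fE p k) ?(fE q k) ?leq_max ?leqnn ?orbT //.
  rewrite scaler_sumr -big_split; apply: eq_bigr => i _ /=.
  by rewrite coefD coefZ scalerDl scalerA.
exists (linear_map lin_f) => k /=; rewrite (fE _ k.+1) ?size_polyXn //.
rewrite big_ord_recr /= coefXn eqxx scale1r big1 ?add0r // => i _.
by rewrite coefXn ltn_eqF ?scale0r.
Qed.

Lemma poly_module_eq (E : lmodType R) (f g : {linear {poly R} -> E}) :
  (forall k, f 'X^k = g 'X^k) -> forall p, f p = g p.
Proof.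
move=> fg p; rewrite -[p]coefK poly_def !linear_sum.
by apply: eq_bigr => i _; rewrite !linearZ fg.
Qed.

Lemma poly_module_projective : projective_module ({poly R} : lmodType R).
Proof.
move=> M N g f g_surj.
have /choice[e eE] : forall k, exists e, g e = f 'X^k by move=> k; apply: g_surj.
have [h hE] := poly_module_lift e; exists h.
by apply: (@poly_module_eq _ (g \o h) f) => k /=; rewrite hE eE.
Qed.

Variable x : R.

Lemma telescope_linear : linear (fun q : {poly R} => q - x *: (q * 'X)).
Proof.
move=> a p q; rewrite mulrDl scalerDr -scalerAl scalerA mulrC -scalerA.
by rewrite scalerBr opprD addrACA.
Qed.

(* Multiplication by [1 - x X]; its cokernel is the localization [R_x], the
   class of ['X^k] being [x^-k]. *)
Definition telescope : {linear {poly R} -> {poly R}} :=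
  linear_map telescope_linear.

Lemma telescopeE q : telescope q = q - x *: (q * 'X). Proof. by []. Qed.

Lemma telescopeXn k : telescope 'X^k = 'X^k - x *: 'X^(k.+1).
Proof. by rewrite telescopeE -exprSr. Qed.

Lemma telescope_coefS q k : (telescope q)`_k.+1 = q`_k.+1 - x * q`_k.
Proof. by rewrite telescopeE coefB coefZ coefMX. Qed.

Lemma telescope_coef0 q : (telescope q)`_0 = q`_0.
Proof. by rewrite telescopeE coefB coefZ coefMX mulr0 subr0. Qed.

Lemma telescope_inj : injective telescope.
Proof.
move=> p q pq; apply/polyP; elim=> [|k IHk].
  by rewrite -[LHS]telescope_coef0 -[RHS]telescope_coef0 pq.
by have := congr1 (fun r : {poly R} => r`_k.+1) pq;
   rewrite /= !telescope_coefS IHk => /addIr.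
Qed.

(** The equation forces [q] to be the geometric series in [x X], whose coefficient at [size q] must
    vanish. *)
Lemma telescope_nilpotent q : telescope q = 1 -> x ^+ size q = 0.
Proof.
move=> q1; have qE k : q`_k = x ^+ k.
  elim: k => [|k IHk]; first by rewrite -telescope_coef0 q1 coef1.
  apply/eqP; rewrite exprS -IHk -subr_eq0 -telescope_coefS q1 coef1.
  by rewrite eqxx.
by rewrite -qE nth_default.
Qed.

End PolynomialModule.

(** * Adic completeness and a linear recurrence *)

Section Completeness.
Variables (R : comNzRingType) (I : set R).

Lemma ideal_pow_ideal k : ideal (ideal_pow I k).
Proof.
split.
- exists 0%N, (fun _ => 0), (fun _ _ => 0); split=> [[]|] //.
  by rewrite big_ord0.
- move=> _ _ [n1 [c1 [y1 [I1 ->]]]] [n2 [c2 [y2 [I2 ->]]]].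
  exists (n1 + n2)%N,
    (fun i => match fintype.split i with inl j => c1 j | inr j => c2 j end),
    (fun i => match fintype.split i with inl j => y1 j | inr j => y2 j end).
  split=> [i j|]; first by case: (fintype.split i).
  rewrite big_split_ord /=; congr (_ + _); apply: eq_bigr => i _.
    by rewrite (unsplitK (inl i)).
  by rewrite (unsplitK (inr i)).
- move=> a _ [n [c [y [Iy ->]]]]; exists n, (fun i => a * c i), y; split=> //.
  by rewrite mulr_sumr; apply: eq_bigr => i _; rewrite mulrA.
Qed.

Lemma ideal_pow_exp x k r : I x -> ideal_pow I k (r * x ^+ k).
Proof.
move=> Ix; exists 1%N, (fun _ => r), (fun _ _ => x); split=> //.
by rewrite big_ord1 prodr_const card_ord.
Qed.

Hypothesis I_complete : adically_complete I.

Lemma complete_recurrence x (b : nat -> R) : I x ->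
  exists a : nat -> R, forall k, b k = a k - x * a k.+1.
Proof.
(* Partial sums of the solution [a_k = b_k + x b_(k+1) + x^2 b_(k+2) + ...]. *)
move=> Ix; pose S k i := \sum_(j < i) x ^+ j * b (k + j)%N.
have SS k i : S k i.+1 = b k + x * S k.+1 i.
  rewrite /S big_ord_recl expr0 mul1r addn0 mulr_sumr; congr (_ + _).
  by apply: eq_bigr => j _; rewrite /= exprS mulrA addSnnS.
have Sadd k i l : S k (i + l)%N = S k i + x ^+ i * S (k + i)%N l.
  rewrite /S big_split_ord /= mulr_sumr; congr (_ + _).
  by apply: eq_bigr => j _; rewrite exprD mulrA addnA.
have idP := ideal_pow_ideal.
have SB k N i j : (N <= i)%N -> (N <= j)%N -> ideal_pow I N (S k i - S k j).
  move=> le_i le_j; rewrite -(subnKC le_i) -(subnKC le_j) !Sadd opprD addrACA.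
  rewrite subrr add0r -mulrBr mulrC; exact: ideal_pow_exp.
have /choice[a aP] : forall k, exists a, adic_limit I (S k) a.
  by move=> k; apply: I_complete.2 => N; exists N => i j; apply: SB.
exists a => k; apply/eqP; rewrite -subr_eq0; apply/eqP/I_complete.1 => N.
have [_ PD PM] := idP N.
have [N1 lim1] := aP k N; have [N2 lim2] := aP k.+1 N.
pose i := maxn N1 N2.
have P1 := lim1 i.+1 (leqW (leq_maxl _ _)).
have P2 := lim2 i (leq_maxr _ _).
(* Modulo [I^N] the limits may be replaced by partial sums, which satisfy the recurrence by [SS]. *)
have -> : b k - (a k - x * a k.+1) =
    (S k i.+1 - a k) + (- x) * (S k.+1 i - a k.+1).
  by rewrite SS; ring.
by apply: PD => //; apply: PM.
Qed.

End Completeness.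

Section GorensteinProjectiveEmbedding.
Variable R : comNzRingType.

(** The cokernel [A] is isomorphic to the image of the next differential, inside a projective
    module, itself a summand of a free one. *)
Lemma gorenstein_projective_embedding (A : lmodType R) :
  gorenstein_projective A ->
  exists (X : choiceType) (f : {linear A -> free_module R X}), injective f.
Proof.
move=> [P [projP acyP _] [p [p_surj ex_p]]].
have [s sK] := projective_section (projP (- 1 + 1 + 1)).
pose d := cplx_diff P (- 1 + 1).
have pd y : p y = 0 <-> d y = 0.
  by rewrite (ex_p y) (acyP (- 1) y).
have [|||f fG] := @linear_of_graph _ A (P (- 1 + 1 + 1))
    [set q | exists y, q = (p y, d y)].
- split; first by exists 0; rewrite !linear0.
  by move=> a _ _ [y ->] [y' ->]; exists (a *: y + y'); rewrite !linearP.
- by move=> _ [y [/esym/pd dy ->]].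
- by move=> a; have [y <-] := p_surj a; exists (d y), y.
exists (P (- 1 + 1 + 1)), (s \o f) => a a' /= saa'.
have faa' : f (a - a') = 0.
  rewrite linearB /=; apply/eqP; rewrite subr_eq0; apply/eqP.
  by rewrite -(sK (f a)) saa' sK.
have [y [aE]] := fG (a - a'); rewrite faa' => /esym/pd py.
by apply/eqP; rewrite -subr_eq0 aE py.
Qed.

End GorensteinProjectiveEmbedding.

(** * The two implications *)

Section Main.
Variables (R : comNzRingType) (m : set R).
Hypotheses (R_local : local_ring m) (R_noetherian : noetherian_ring R).

Lemma complete_localization_nil x : adically_complete m -> m x ->
  (left_perp (R^o : lmodType R) (cokernel (telescope x)) ->
   gorenstein_projective (cokernel (telescope x))) ->
  exists k, x ^+ k = 0.
Proof.
move=> R_complete mx perp_gproj.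
have [p p_exact] : exists p : {linear {poly R} -> cokernel (telescope x)},
    exact_at (telescope x) p.
  by exists (cokernel_map (telescope x)); apply: cokernel_exact.
have [|X [f f_inj]] := gorenstein_projective_embedding (perp_gproj _).
  apply: short_resolution_left_perp; try exact: poly_module_projective.
    exact: telescope_inj.
  (* A map [h] on [R[X]] is the sequence of its values on powers of [X]; a solution of the
     recurrence defines its extension along the telescope. *)
  move=> h; have [a aE] := complete_recurrence R_complete
    (fun k => h 'X^k : R) mx.
  have [g gE] := @poly_module_lift R (R^o) a; exists g.
  apply: (@poly_module_eq _ _ h (g \o telescope x)) => k.
  rewrite -[RHS]/(g (telescope x 'X^k)) telescopeXn linearB linearZ /= !gE.
  exact: aE.
have pX k : p 'X^k = x *: p 'X^(k.+1).
  apply/eqP; rewrite -subr_eq0 -linearZ -linearB -telescopeXn; apply/eqP.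
  by apply/p_exact; exists 'X^k.
have p1 k : p 1 = x ^+ k *: p 'X^k.
  elim: k => [|k ->]; first by rewrite scale1r.
  by rewrite exprSr -scalerA -pX.
have : p 1 = 0.
  apply: f_inj; apply: fcoefP => y; rewrite linear0 fcoef0.
  (* Every coordinate of [f (p 1)] is a multiple of [x^k] for all [k]. *)
  apply: R_complete.1 => k; rewrite (p1 k) linearZ fcoefZ mulrC.
  exact: ideal_pow_exp.
by move=> /p_exact[q /esym/telescope_nilpotent]; exists (size q).
Qed.

(** As [m^n = 0], Cauchy sequences are eventually constant. *)
Lemma nilpotent_complete n : nilpotent_power m n -> adically_complete m.
Proof.
move=> m_nilpotent.
have pow0 x : ideal_pow m n x -> x = 0.
  move=> [k [c [y [my ->]]]]; apply: big1 => i _.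
  have -> : \prod_(j < n) y i j = \prod_(z <- codom (y i)) z.
    by rewrite big_image.
  rewrite m_nilpotent ?mulr0 // ?size_codom ?card_ord //.
  by move=> z /codomP[j ->].
split=> [x /(_ n)/pow0 //|x /(_ n)[N xN]].
exists (x N) => k; exists N => i le_Ni.
rewrite (pow0 (x i - x N)); last exact: xN.
by have [] := ideal_pow_ideal m k.
Qed.

End Main.

Theorem proposition5p14 (R : comNzRingType) (m : set R)
    (R_local : local_ring m) (R_noetherian : noetherian_ring R)
    (R_gorenstein : gorenstein_ring R) :
  (adically_complete m /\
   (forall A : lmodType R,
      left_perp (GRing.regular R : lmodType R) A <-> gorenstein_projective A))
  <-> artinian_ring R.
Proof.
split=> [[R_complete perp_gproj]|R_artinian].
  have [x mx|n m_nilpotent] := nil_nilpotent R_local R_noetherian.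
    by apply: complete_localization_nil mx (perp_gproj _).1.
  exact: nilpotent_artinian m_nilpotent.
have [n m_nilpotent] := nil_nilpotent R_local R_noetherian
  (artinian_nil R_local R_noetherian R_artinian).
have [d injdim] := R_gorenstein.
have R_injective :=
  finite_injdim_injective R_local R_noetherian m_nilpotent injdim.
split=> [|A]; first exact: nilpotent_complete m_nilpotent.
split=> _; last exact: injective_left_perp.
apply: quasi_frobenius_gorenstein_projective.
  exact: projective_injective R_local R_noetherian m_nilpotent R_injective.
exact: free_embedding R_local R_noetherian m_nilpotent R_injective.
Qed.
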